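(* For each integer $m\ge0$ there exists a constant $C_m>0$, independent of $t>0$ and $x\ge0$, such that for all $t>0$ and $x\ge 0$ $$\int_0^\infty\bigl|\partial_x^{m}K(t,x,y)\bigr|\,dy\le C_m\,t^{-m/4}.$$
   Context: For $r\ge0$ let $\Phi(r):=e^{-r}+\sin r-\cos r$. For $t>0$ and $x,y\ge0$ the kernel $K$ is $$K(t,x,y):=\frac1\pi\int_0^\infty e^{-k^4t}\,\Phi(kx)\,\Phi(ky)\,dk .$$ *)

(* Defs.v *)
From mathcomp Require Import all_boot all_order all_algebra.
From mathcomp Require Import all_classical all_reals all_analysis.

Set Implicit Arguments.
Unset Strict Implicit.
Unset Printing Implicit Defensive.

Import Order.TTheory GRing.Theory Num.Theory.
Import numFieldNormedType.Exports.

Local Open Scope classical_set_scope.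
Local Open Scope ring_scope.

Definition Phi (R : realType) (r : R) : R := expR (- r) + sin r - cos r.

Definition kernelK (R : realType) (t x y : R) : R :=
  pi^-1 * \int[lebesgue_measure]_(k in `[0, +oo[)
            (expR (- (k ^+ 4 * t)) * Phi (k * x) * Phi (k * y)).

(* Derivative of a function on the half-line [0, +oo[: the difference quotient
   only uses the values of f on [0, +oo[, so this is the usual derivative at
   x > 0 and the right derivative at x = 0. *)
Definition derive_ge0 (R : realType) (f : R -> R) (x : R) : R :=
  lim ((z - x)^-1 * (f z - f x) @[z --> within `[0, +oo[ x^']).

Definition deriven_ge0 (R : realType) (n : nat) (f : R -> R) : R -> R :=
  iter n (@derive_ge0 R) f.

(* Main.v *)
Require Import Defs.
From mathcomp Require Import all_boot all_order all_algebra.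
From mathcomp Require Import all_classical all_reals all_analysis.
From mathcomp Require Import measurable_realfun zify ring lra.

(** Write [a := t ^ (1/4)], so that the weight of the kernel is
    [expR (- (a * k) ^+ 4)]. Differentiating [m] times in [x] under the integral
    sign turns the kernel into [pi^-1 * a ^- m * J], where [J] integrates
    g(k) Phi^(m)(k x) Phi(k y) over the half-line and
    g(k) = (a k) ^ m expR (- (a k) ^ 4) ([deriven_ge0_kernelK]). The derivatives
    of [Phi] are bounded on the half-line, hence |J| <= C / a.

    The integral over [y] needs decay in [y - x] on top of that, and [Phi] does
    not decay: the decay comes from oscillation, and from the boundary
    conditions of [Phi]. Since Phi'''' = Phi, the product
    Phi^(m)(k x) Phi(k y) multiplied by D = y ^ 4 - x ^ 4 is the derivative in
    [k] of a bilinear concomitant of third order ([concomitant1]), and the same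
    construction applies once more ([concomitant2]). Integrating by parts twice
    thus gives D ^ 2 J as the integral of g'' times the second concomitant
    ([oscint_green]). The boundary terms at [k = 0] cancel because
    Phi(0) = Phi'(0) = 0 and Phi'''' = Phi ([dPhi_mul_at0]). The second
    concomitant is bounded by a multiple of S ^ 2, where
    S = y ^ 3 + x y ^ 2 + x ^ 2 y + x ^ 3, and D = (y - x) S, so S cancels and
    (y - x) ^ 2 |J| <= C a.

    Both bounds together say that |J| is at most a constant multiple of the
    Cauchy density a^-1 / (1 + ((y - x) / a) ^ 2) ([oscint_cauchy]), whose
    integral is at most [pi]; the factor [a ^- m] is the power of [t] in the
    claim. *)

Import Order.TTheory GRing.Theory Num.Theory.
Import numFieldNormedType.Exports.

Local Open Scope classical_set_scope.
Local Open Scope ring_scope.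

Set Implicit Arguments.
Unset Strict Implicit.
Unset Printing Implicit Defensive.

(** * Exponentially bounded functions on the half-line *)

Section HalfLine.
Variable R : realType.
Notation mu := (@lebesgue_measure R).
Implicit Types (f F : R -> R) (a M N k : R).

(** The class of all integrands in [k] below. The constant [M] is kept explicit
    because the final estimate has to be uniform in everything that
    enters only through [M] and [a]. *)
Definition exp_bounded a M f :=
  continuous f /\ forall k, 0 <= k -> `|f k| <= M * expR (- (a * k)).

Lemma is_derive_continuous f (df : R -> R) :
  (forall x, is_derive x (1 : R) f (df x)) -> continuous f.
Proof.
move=> H x; apply: differentiable_continuous; apply/derivable1_diffP.
by have := H x; case.
Qed.

Lemma is_derive_expRM (c x : R) :
  is_derive x (1 : R) (fun k => expR (- (c * k))) (- c * expR (- (c * x))).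
Proof.
have H : is_derive x (1 : R) (fun k : R => - (c * k)) (- c).
  have -> : (fun k : R => - (c * k)) = (- c) *: id by apply/funext => z; rewrite -mulNr.
  by apply: is_derive_eq; rewrite /GRing.scale /= mulr1.
have := @is_derive1_comp R expR (fun k : R => - (c * k)) x _ _ (is_derive_expR (- (c * x))) H.
by move=> H'; apply: is_derive_eq; rewrite mulrC.
Qed.

Lemma continuous_expRM (c : R) : continuous (fun k => expR (- (c * k))).
Proof. exact: is_derive_continuous (is_derive_expRM c). Qed.

Lemma cvg_expRM a : 0 < a -> expR (- (a * k)) @[k --> +oo] --> (0 : R).
Proof.
move=> a0; have H : a * k @[k --> +oo] --> +oo by apply: gt0_cvgMry => //; exact: cvg_id.
exact: (cvg_comp _ _ H (@cvgr_expR R)).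
Qed.

Lemma exp_bounded_cvg0 a M f : 0 < a -> exp_bounded a M f -> f k @[k --> +oo] --> (0 : R).
Proof.
move=> a0 [_ fM]; apply: norm_cvg0.
apply: (@squeeze_cvgr _ _ _ _ (cst 0) (fun k => M * expR (- (a * k)))).
- near=> k; rewrite normr_ge0 /=; apply: fM; near: k; exact: nbhs_pinfty_ge.
- exact: cvg_cst.
- rewrite -[X in _ --> X](mulr0 M); apply: cvgMl_tmp; exact: cvg_expRM.
Unshelve. all: by end_near. Qed.

Lemma ge0_FTC_half_line (f F : R -> R) (l : R) :
  (forall k, 0 <= k -> 0 <= f k) -> continuous f ->
  (forall k, is_derive k (1 : R) F (f k)) -> F k @[k --> +oo] --> l ->
  (\int[mu]_(k in `[0%R, +oo[) (f k)%:E = (l - F 0)%:E)%E.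
Proof.
move=> f0 cf dF Fl; have cF := is_derive_continuous dF.
rewrite (@ge0_continuous_FTC2y _ f F 0 l) //.
- exact: continuous_subspaceT.
- apply: cvg_at_right_filter; exact: cF.
- move=> k _; rewrite derive1E; exact: (@derive_val _ _ _ _ _ _ _ (dF k)).
Qed.

Lemma integral_expRM a : 0 < a ->
  (\int[mu]_(k in `[0%R, +oo[) (expR (- (a * k)))%:E = (a^-1)%:E)%E.
Proof.
move=> a0; have dF k : is_derive k (1 : R) (fun k => - a^-1 * expR (- (a * k))) (expR (- (a * k))).
  have H := is_deriveZ (- a^-1) (is_derive_expRM a k).
  apply: is_derive_eq; rewrite /GRing.scale /=; field; lra.
have Fl : - a^-1 * expR (- (a * k)) @[k --> +oo] --> (0 : R).
  rewrite -(mulr0 (- a^-1)); apply: cvgMl_tmp; exact: cvg_expRM.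
rewrite (ge0_FTC_half_line _ (@continuous_expRM a) dF Fl) //.
by rewrite mulr0 oppr0 expR0 mulr1 sub0r opprK.
Qed.

Lemma exp_boundedZ a M f (c : R) : exp_bounded a M f ->
  exp_bounded a (`|c| * M) (fun k => c * f k).
Proof.
move=> [cf fM]; split; first by move=> k; apply: cvgMl_tmp; exact: cf.
by move=> k k0; rewrite normrM -mulrA ler_wpM2l // fM.
Qed.

Lemma exp_boundedB a M N f F : exp_bounded a M f -> exp_bounded a N F ->
  exp_bounded a (M + N) (fun k => f k - F k).
Proof.
move=> [cf fM] [cF FN]; split; first by move=> k; apply: cvgB; [exact: cf|exact: cF].
by move=> k k0; rewrite (le_trans (ler_normB _ _)) // mulrDl lerD ?fM ?FN.
Qed.

Lemma exp_bounded_measurable a M f : exp_bounded a M f ->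
  measurable_fun (`[0, +oo[ : set R) f.
Proof. by case=> cf _; apply: measurable_funTS; exact: continuous_measurable_fun. Qed.

Lemma integrable_expRM a : 0 < a ->
  mu.-integrable `[0, +oo[ (EFin \o (fun k => expR (- (a * k)))).
Proof.
move=> a0; apply/integrableP; split.
  apply/measurable_EFinP; apply: measurable_funTS; apply: continuous_measurable_fun.
  exact: continuous_expRM.
apply: (@le_lt_trans _ _ (a^-1)%:E); last exact: ltry.
rewrite -(integral_expRM a0) le_eqVlt; apply/orP; left; apply/eqP.
by apply: eq_integral => k _; rewrite /= ger0_norm // expR_ge0.
Qed.

Lemma exp_bounded_integrable a M f : 0 < a -> exp_bounded a M f ->
  mu.-integrable `[0, +oo[ (EFin \o f).
Proof.
move=> a0 fM; have I := @integrableZl _ _ _ mu _ (measurable_itv _) M _ (integrable_expRM a0).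
apply: le_integrable I => //.
  by apply/measurable_EFinP; exact: exp_bounded_measurable fM.
move=> k; rewrite /= in_itv /= andbT => k0; rewrite lee_fin.
by rewrite (le_trans (fM.2 _ k0)) // ler_norm.
Qed.

Lemma Rintegral_expRM a : 0 < a ->
  \int[mu]_(k in `[0, +oo[) expR (- (a * k)) = a^-1.
Proof. by move=> a0; rewrite /Rintegral integral_expRM. Qed.

Lemma exp_bounded_Rintegral a M f : 0 < a -> exp_bounded a M f ->
  `|\int[mu]_(k in `[0, +oo[) f k| <= M / a.
Proof.
move=> a0 fM; have If := exp_bounded_integrable a0 fM.
apply: le_trans (le_normr_Rintegral _ If) _ => //.
rewrite -(Rintegral_expRM a0) -RintegralZl //; last exact: integrable_expRM.
apply: le_Rintegral => //.
- exact: integrable_norm.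
- exact: @integrableZl _ _ _ mu _ (measurable_itv _) M _ (integrable_expRM a0).
- by move=> k; rewrite /= in_itv /= andbT => k0; exact: fM.2.
Qed.

(** Adding [M * expR (- (a * k))], which has an explicit primitive, makes [f]
    non-negative; this reduces the signed case to [ge0_FTC_half_line]. *)
Lemma exp_bounded_FTC a M M' f F : 0 < a ->
  exp_bounded a M f -> exp_bounded a M' F ->
  (forall k, is_derive k (1 : R) F (f k)) ->
  \int[mu]_(k in `[0, +oo[) f k = - F 0.
Proof.
move=> a0 fM FM dF; have If := exp_bounded_integrable a0 fM.
pose e k := expR (- (a * k)).
have Ie : mu.-integrable `[0, +oo[ (EFin \o (fun k => M * e k)).
  exact: @integrableZl _ _ _ mu _ (measurable_itv _) M _ (integrable_expRM a0).
have : \int[mu]_(k in `[0, +oo[) (f k + M * e k) = M / a - F 0.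
  have dG k : is_derive k (1 : R) (fun k => F k + (- (M / a)) * e k) (f k + M * e k).
    have H := is_deriveZ (- (M / a)) (is_derive_expRM a k).
    have H' := is_deriveD (dF k) H.
    apply: is_derive_eq; rewrite /GRing.scale /= /e; congr (_ + _); field; lra.
  have Gl : F k + (- (M / a)) * e k @[k --> +oo] --> (0 : R).
    rewrite -(addr0 0) -[X in _ --> _ + X](mulr0 (- (M / a))); apply: cvgD.
      exact: exp_bounded_cvg0 FM.
    by apply: cvgMl_tmp; exact: cvg_expRM.
  have G0 k : 0 <= k -> 0 <= f k + M * e k.
    by move=> k0; have := fM.2 _ k0; rewrite ler_norml -lerBlDr sub0r => /andP[].
  have cG : continuous (fun k => f k + M * e k).
    move=> k; apply: cvgD; first exact: fM.1.
    by apply: cvgMl_tmp; exact: continuous_expRM.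
  rewrite /Rintegral (ge0_FTC_half_line G0 cG dG Gl) /=.
  rewrite /e mulr0 oppr0 expR0; ring.
rewrite RintegralD // RintegralZl ?Rintegral_expRM //; last exact: integrable_expRM.
by move=> H; lra.
Qed.

End HalfLine.

(** * The derivatives of the profile, and the weight *)

Section Profile.
Variable R : realType.
Implicit Types (r s x y k : R) (i j n : nat).

(** The [n]-th derivative of [Phi]: differentiating the trigonometric part
    shifts its argument by a quarter turn. *)
Definition dPhi n r : R :=
  (-1) ^+ n * expR (- r) + sin (r + n%:R * (pi / 2)) - cos (r + n%:R * (pi / 2)).

Lemma dPhi0 r : dPhi 0 r = Phi r.
Proof. by rewrite /dPhi /Phi expr0 mul0r addr0 mul1r. Qed.

Lemma is_derive_dPhi n r : is_derive r (1 : R) (dPhi n) (dPhi n.+1 r).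
Proof.
have Hs : is_derive r (1 : R) (fun u => u + n%:R * (pi / 2)) 1.
  by apply: is_derive_eq; rewrite addr0.
pose g (u : R) := u + n%:R * (pi / 2).
have H1 := @is_derive1_comp R sin g r _ _ (is_derive_sin (r + n%:R * (pi / 2))) Hs.
have H2 := @is_derive1_comp R cos g r _ _ (is_derive_cos (r + n%:R * (pi / 2))) Hs.
have H3 := is_derive_expRM 1 r.
have H4 := is_deriveZ ((-1) ^+ n) H3.
have H := is_deriveB (is_deriveD H4 H1) H2.
have -> : dPhi n = (((-1) ^+ n \*: (fun k : R => expR (- (1 * k)))) \+
   (sin \o (fun u => u + n%:R * (pi / 2)))) \- (cos \o (fun u => u + n%:R * (pi / 2))).
  by apply/funext => u; rewrite /dPhi /= mul1r.
apply: is_derive_eq.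
rewrite /dPhi /GRing.scale /= !mulr1 ?mul1r.
rewrite (_ : r + n.+1%:R * (pi / 2) = r + n%:R * (pi / 2) + pi / 2); last first.
  by rewrite -[n.+1%:R]natr1; ring.
rewrite sinDpihalf cosDpihalf exprS; ring.
Qed.

Lemma dPhi_bound n r : 0 <= r -> `|dPhi n r| <= 3.
Proof.
move=> r0; rewrite /dPhi; have := expR_ge0 (- r); have : expR (- r) <= 1.
  by rewrite expR_le1 oppr_le0.
set e := expR _ => e1 e0.
have := sin_le1 (r + n%:R * (pi / 2)); have := sin_geN1 (r + n%:R * (pi / 2)).
have := cos_le1 (r + n%:R * (pi / 2)); have := cos_geN1 (r + n%:R * (pi / 2)).
set c := cos _; set s := sin _ => ? ? ? ?.
rewrite -signr_odd ler_norml; case: (odd n); rewrite ?expr1 ?expr0; apply/andP; split; lra.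
Qed.

Lemma dPhiD4 n r : dPhi n.+4 r = dPhi n r.
Proof.
rewrite /dPhi (_ : r + n.+4%:R * (pi / 2) = r + n%:R * (pi / 2) + pi *+ 2).
  by rewrite sinD2pi cosD2pi !exprS; ring.
by rewrite -addn4 natrD mulrDl addrA -mulr_natr; congr (_ + _); field.
Qed.

(** [Phi] satisfies the boundary conditions [Phi 0 = Phi' 0 = 0], which the
    period 4 propagates to half of all its derivatives. *)
Lemma dPhi_at0 n : (n %% 4 < 2)%N -> dPhi n 0 = 0.
Proof.
rewrite {2}(divn_eq n 4); move: (n %/ 4)%N (n %% 4)%N => q r.
have -> : dPhi (q * 4 + r) 0 = dPhi r 0.
  by elim: q => // q IH; rewrite mulSn -addnA dPhiD4.
case: r => [|[|]] // _; rewrite /dPhi ?expr0 ?expr1 oppr0 expR0 ?mul0r ?mul1r ?addr0 ?add0r.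
  by rewrite sin0 cos0; ring.
by rewrite sin_pihalf cos_pihalf; ring.
Qed.

(** Why the concomitants vanish at [k = 0]: two indices that are both 2 or 3
    modulo 4 cannot add up to 3 modulo 4, so one of the factors vanishes. *)
Lemma dPhi_mul_at0 i j : (i + j = 3 %[mod 4])%N -> dPhi i 0 * dPhi j 0 = 0.
Proof.
move=> ij; have [/dPhi_at0 ->|i2] := ltnP (i %% 4) 2; first by rewrite mul0r.
have [/dPhi_at0 ->|j2] := ltnP (j %% 4) 2; first by rewrite mulr0.
move: ij i2 j2; rewrite -modnDm; have := ltn_pmod i (isT : 0 < 4)%N.
have := ltn_pmod j (isT : 0 < 4)%N.
by move: (i %% 4)%N (j %% 4)%N => [|[|[|[|]]]] // [|[|[|[|]]]].
Qed.

Lemma dPhi_lip n r s : 0 <= r -> 0 <= s -> `|dPhi n r - dPhi n s| <= 3 * `|r - s|.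
Proof.
wlog rs : r s / s <= r.
  move=> H r0 s0; have [|/ltW] := leP s r => rs; first exact: H.
  by rewrite distrC [X in _ <= _ * X]distrC; exact: H.
move=> r0 s0.
have cP : {within `[s, r], continuous (dPhi n)}.
  by apply: continuous_subspaceT; exact: is_derive_continuous (is_derive_dPhi n).
have [c] := MVT_segment rs (fun x _ => is_derive_dPhi n x) cP.
rewrite in_itv /= => /andP[sc _] ->; rewrite normrM ler_wpM2r // dPhi_bound //.
exact: le_trans sc.
Qed.

Lemma dPhi_taylor n r s : 0 <= r -> 0 <= s ->
  `|dPhi n r - dPhi n s - (r - s) * dPhi n.+1 s| <= 3 * (r - s) ^+ 2.
Proof.
move=> r0 s0.
have [c [c0 cs ->]] : exists c, [/\ 0 <= c, `|c - s| <= `|r - s| &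
    dPhi n r - dPhi n s = dPhi n.+1 c * (r - s)].
  have cP A : {within A, continuous (dPhi n)}.
    by apply: continuous_subspaceT; exact: is_derive_continuous (is_derive_dPhi n).
  have [rs|/ltW rs] := leP s r.
    have [c] := MVT_segment rs (fun x _ => is_derive_dPhi n x) (cP _).
    rewrite in_itv /= => /andP[sc cr] ->; exists c; split => //; first exact: le_trans sc.
    by rewrite !ger0_norm ?subr_ge0 // lerD2r.
  have [c] := MVT_segment rs (fun x _ => is_derive_dPhi n x) (cP _).
  rewrite in_itv /= => /andP[sc cr] E; exists c; split; first exact: le_trans sc.
    by rewrite !ler0_norm ?subr_le0 // lerN2 lerD2r.
  by rewrite -opprB E -mulrN opprB.
rewrite mulrC -mulrBr normrM -real_normK ?num_real // expr2 mulrCA.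
rewrite ler_wpM2l // (le_trans (dPhi_lip _ _ _)) // ler_wpM2l //.
Qed.

End Profile.

Section Weight.
Variable R : realType.
Implicit Types (p : {poly R}) (s a k : R).

Definition qexp p s : R := p.[s] * expR (- s ^+ 4).

(** Derivation on polynomials that corresponds to differentiating [qexp p]; it
    does not involve the scaling parameter [a], which is why all constants
    obtained from [qexp_bound] are independent of time. *)
Definition qderiv p : {poly R} := p^`() - 4 *: ('X^3 * p).

Lemma is_derive_qexp p s : is_derive s (1 : R) (qexp p) (qexp (qderiv p) s).
Proof.
have H4 : is_derive s (1 : R) (fun u : R => - u ^+ 4) (- (4 * s ^+ 3)).
  by apply: is_derive_eq; rewrite /GRing.scale /=; ring.
have He := @is_derive1_comp R expR (fun u : R => - u ^+ 4) s _ _ (is_derive_expR (- s ^+ 4)) H4.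
have H := is_deriveM (is_derive_poly p s) He.
have -> : qexp p = horner p * (expR \o (fun u : R => - u ^+ 4)) by [].
apply: is_derive_eq.
rewrite /qexp /qderiv /GRing.scale /= hornerD hornerN hornerZ hornerM hornerXn; ring.
Qed.

Lemma is_derive_qexpM p a k :
  is_derive k (1 : R) (fun k => qexp p (a * k)) (a * qexp (qderiv p) (a * k)).
Proof.
have Ha : is_derive k (1 : R) (fun k : R => a * k) a.
  by apply: is_derive_eq; rewrite /GRing.scale /= mulr1.
have H := @is_derive1_comp R (qexp p) (fun k : R => a * k) k _ _ (is_derive_qexp p (a * k)) Ha.
by rewrite mulrC.
Qed.

Lemma poly_le_expR p : exists2 C : R, 0 <= C &
  forall s, 0 <= s -> `|p.[s]| <= C * expR s.
Proof.
exists (\sum_(i < size p) `|p`_i| * i`!%:R).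
  by apply: sumr_ge0 => i _; apply: mulr_ge0.
move=> s s0; rewrite horner_coef mulr_suml (le_trans (ler_norm_sum _ _ _)) //.
apply: ler_sum => i _; rewrite normrM -mulrA ler_wpM2l // normrX ger0_norm //.
case: (nat_of_ord i) => [|n].
  by rewrite expr0 fact0 mul1r -expR0 ler_expR.
rewrite mulrC -ler_pdivrMr ?ltr0n ?fact_gt0 //.
by apply: le_trans (expR_ge1Dxn n s0); rewrite lerDr.
Qed.

Lemma qexp_bound p : exists2 C : R, 0 <= C &
  forall s, 0 <= s -> `|qexp p s| <= C * expR (- s).
Proof.
have [C C0 Cp] := poly_le_expR p; exists (C * expR 2).
  by rewrite mulr_ge0 // expR_ge0.
move=> s s0; rewrite /qexp normrM (ger0_norm (expR_ge0 _)).
rewrite (le_trans (ler_wpM2r (expR_ge0 _) (Cp _ s0))) // -!mulrA.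
rewrite ler_wpM2l // -!expRD ler_expR.
(* 2 + s ^ 4 - 2 s = (s ^ 2 - 1) ^ 2 + (2 s - 1) ^ 2 / 2 + 1 / 2 *)
suff : 2 * s <= 2 + s ^+ 4 by lra.
have : 0 <= (s ^+ 2 - 1) ^+ 2 by exact: sqr_ge0.
have : 0 <= (2 * s - 1) ^+ 2 by exact: sqr_ge0.
rewrite !expr2 !exprS expr0; lra.
Qed.

End Weight.

(** * Bilinear concomitants *)

Section Lagrange.
Variable R : realType.
Implicit Types (x y k : R) (P : nat -> nat -> R) (i j : nat).

(** Bilinear concomitant of the fourth derivative. For H(k) = h(k x) and
    F(k) = f(k y), with [P i j] the product of the [i]-th derivative of h at k x
    by the [j]-th derivative of f at k y, the case [i = j = 0] reads
    F'''H - F''H' + F'H'' - FH'''. *)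
Definition concomitant x y P i j : R :=
  y ^+ 3 * P i j.+3 - x * y ^+ 2 * P i.+1 j.+2
  + x ^+ 2 * y * P i.+2 j.+1 - x ^+ 3 * P i.+3 j.

Definition dPhi_prod x y k i j : R := dPhi i (k * x) * dPhi j (k * y).

Lemma is_derive_dPhi_prod x y i j k :
  is_derive k (1 : R) (fun k => dPhi_prod x y k i j)
    (x * dPhi_prod x y k i.+1 j + y * dPhi_prod x y k i j.+1).
Proof.
have D (c : R) : is_derive k (1 : R) (fun k : R => k * c) c.
  by apply: is_derive_eq; rewrite /GRing.scale /= mulr1 mulr0 add0r.
have Hx := @is_derive1_comp R (dPhi i) (fun k : R => k * x) k _ _
  (is_derive_dPhi i (k * x)) (D x).
have Hy := @is_derive1_comp R (dPhi j) (fun k : R => k * y) k _ _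
  (is_derive_dPhi j (k * y)) (D y).
have H := is_deriveM Hx Hy.
have -> : (fun k => dPhi_prod x y k i j) =
  (dPhi i \o (fun k : R => k * x)) * (dPhi j \o (fun k : R => k * y)) by [].
by apply: is_derive_eq; rewrite /dPhi_prod /GRing.scale /=; ring.
Qed.

Lemma is_derive_concomitant x y (P : R -> nat -> nat -> R) (dP : nat -> nat -> R) i j k :
  (forall i j, is_derive k (1 : R) (fun k => P k i j) (dP i j)) ->
  is_derive k (1 : R) (fun k => concomitant x y (P k) i j) (concomitant x y dP i j).
Proof.
move=> H; rewrite /concomitant.
have H1 := is_deriveZ (y ^+ 3) (H i j.+3).
have H2 := is_deriveZ (x * y ^+ 2) (H i.+1 j.+2).
have H3 := is_deriveZ (x ^+ 2 * y) (H i.+2 j.+1).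
have H4 := is_deriveZ (x ^+ 3) (H i.+3 j).
exact: is_deriveB (is_deriveD (is_deriveB H1 H2) H3) H4.
Qed.

(** Lagrange identity: when the fourth derivative acts as the identity on both
    factors, the derivative of the concomitant telescopes to
    F''''H - FH'''' = (y ^ 4 - x ^ 4) F H. *)
Lemma concomitant_telescope x y P i j :
  (forall i j, P i.+4 j = P i j) -> (forall i j, P i j.+4 = P i j) ->
  concomitant x y (fun i j => x * P i.+1 j + y * P i j.+1) i j = (y ^+ 4 - x ^+ 4) * P i j.
Proof. by move=> Pi Pj; rewrite /concomitant !Pi !Pj; ring. Qed.

(** The sum of the absolute values of the coefficients of [concomitant] at
    non-negative [x] and [y]. *)
Definition coef_sum x y : R := y ^+ 3 + x * y ^+ 2 + x ^+ 2 * y + x ^+ 3.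

Lemma concomitant_bound x y P i j (B : R) : 0 <= x -> 0 <= y ->
  (forall i j, `|P i j| <= B) ->
  `|concomitant x y P i j| <= coef_sum x y * B.
Proof.
move=> x0 y0 PB; have E c u v : 0 <= c -> `|c * P u v| <= c * B.
  by move=> c0; rewrite normrM (ger0_norm c0) ler_wpM2l.
rewrite /concomitant /coef_sum (le_trans (ler_normB _ _)) // !mulrDl lerD ?E ?exprn_ge0 //.
rewrite (le_trans (ler_normD _ _)) // lerD ?E ?mulr_ge0 ?exprn_ge0 //.
by rewrite (le_trans (ler_normB _ _)) // lerD ?E ?mulr_ge0 ?exprn_ge0.
Qed.

Lemma dPhi_prodD4l x y k i j : dPhi_prod x y k i.+4 j = dPhi_prod x y k i j.
Proof. by rewrite /dPhi_prod dPhiD4. Qed.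

Lemma dPhi_prodD4r x y k i j : dPhi_prod x y k i j.+4 = dPhi_prod x y k i j.
Proof. by rewrite /dPhi_prod dPhiD4. Qed.

Lemma dPhi_prod_bound x y k i j : 0 <= x -> 0 <= y -> 0 <= k -> `|dPhi_prod x y k i j| <= 9.
Proof.
move=> x0 y0 k0; rewrite /dPhi_prod normrM (_ : 9 = 3 * 3); last by ring.
by apply: ler_pM => //; apply: dPhi_bound; apply: mulr_ge0.
Qed.

Lemma continuous_dPhi_prod x y i j : continuous (fun k => dPhi_prod x y k i j).
Proof. exact: is_derive_continuous (is_derive_dPhi_prod x y i j). Qed.

Definition concomitant1 x y k := concomitant x y (dPhi_prod x y k).

Lemma is_derive_concomitant1 x y i j k :
  is_derive k (1 : R) (fun k => concomitant1 x y k i j) ((y ^+ 4 - x ^+ 4) * dPhi_prod x y k i j).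
Proof.
have := is_derive_concomitant x y i j (fun i j => is_derive_dPhi_prod x y i j k).
rewrite concomitant_telescope //; first exact: dPhi_prodD4l.
exact: dPhi_prodD4r.
Qed.

(** The concomitant depends linearly on its family, so applying it again yields
    an antiderivative of [(y ^ 4 - x ^ 4) * concomitant1]. *)
Definition concomitant2 x y k := concomitant x y (concomitant1 x y k).

Lemma is_derive_concomitant2 x y i j k :
  is_derive k (1 : R) (fun k => concomitant2 x y k i j)
    ((y ^+ 4 - x ^+ 4) * concomitant1 x y k i j).
Proof.
have H := is_derive_concomitant x y i j (fun i j => is_derive_concomitant1 x y i j k).
by apply: is_derive_eq; rewrite /concomitant1 /concomitant; ring.
Qed.

Lemma concomitant1_at0 x y i j : (i + j = 0 %[mod 4])%N -> concomitant1 x y 0 i j = 0.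
Proof.
move=> ij; rewrite /concomitant1 /concomitant /dPhi_prod !mul0r.
by rewrite !dPhi_mul_at0 ?mulr0 ?subr0 ?addr0 //; lia.
Qed.

Lemma concomitant2_at0 x y i j : (i + j = 1 %[mod 4])%N -> concomitant2 x y 0 i j = 0.
Proof.
move=> ij; rewrite /concomitant2 /concomitant !concomitant1_at0 ?mulr0 ?subr0 ?addr0 //; lia.
Qed.

End Lagrange.

(** * Decay of the oscillatory integrals *)

Section OscillatoryIntegral.
Variable R : realType.
Notation mu := (@lebesgue_measure R).
Implicit Types (a x y k B C : R) (p : {poly R}) (i j m : nat) (h : R -> R).

Lemma exp_bounded_qexpM p a B C h : 0 < a -> 0 <= C ->
  (forall s, 0 <= s -> `|qexp p s| <= C * expR (- s)) ->
  continuous h -> (forall k, 0 <= k -> `|h k| <= B) ->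
  exp_bounded a (C * B) (fun k => qexp p (a * k) * h k).
Proof.
move=> a0 C0 HC ch hB; split.
  move=> k; apply: cvgM; last exact: ch.
  exact: is_derive_continuous (is_derive_qexpM p a) _.
move=> k k0; rewrite normrM mulrAC ler_pM //; last exact: hB.
by apply: HC; rewrite mulr_ge0 // ltW.
Qed.

(** Up to the factor [pi^-1 * a ^- m], the [m]-th derivative in [x] of the kernel
    at time [a ^+ 4] is [oscint 'X^m m 0 a x y]. *)
Definition oscint p i j a x y : R :=
  \int[mu]_(k in `[0, +oo[) (qexp p (a * k) * dPhi_prod x y k i j).

Lemma oscint_exp_bounded p : exists2 C, 0 <= C & forall i j a x y,
  0 < a -> 0 <= x -> 0 <= y ->
  exp_bounded a C (fun k => qexp p (a * k) * dPhi_prod x y k i j).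
Proof.
have [C C0 HC] := qexp_bound p; exists (C * 9); first by rewrite mulr_ge0.
move=> i j a x y a0 x0 y0; apply: exp_bounded_qexpM => //.
  exact: continuous_dPhi_prod.
by move=> k k0; exact: dPhi_prod_bound.
Qed.

Lemma oscint_bound p : exists2 C, 0 <= C & forall i j a x y,
  0 < a -> 0 <= x -> 0 <= y -> `|oscint p i j a x y| <= C / a.
Proof.
have [C C0 HC] := oscint_exp_bounded p; exists C => // i j a x y a0 x0 y0.
exact: exp_bounded_Rintegral a0 (HC i j a x y a0 x0 y0).
Qed.

Lemma concomitant1_bound x y i j k : 0 <= x -> 0 <= y -> 0 <= k ->
  `|concomitant1 x y k i j| <= coef_sum x y * 9.
Proof. by move=> x0 y0 k0; apply: concomitant_bound => // u v; exact: dPhi_prod_bound. Qed.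

Lemma concomitant2_bound x y i j k : 0 <= x -> 0 <= y -> 0 <= k ->
  `|concomitant2 x y k i j| <= coef_sum x y * (coef_sum x y * 9).
Proof. by move=> x0 y0 k0; apply: concomitant_bound => // u v; exact: concomitant1_bound. Qed.

Lemma continuous_concomitant1 x y i j : continuous (fun k => concomitant1 x y k i j).
Proof. exact: is_derive_continuous (is_derive_concomitant1 x y i j). Qed.

Lemma continuous_concomitant2 x y i j : continuous (fun k => concomitant2 x y k i j).
Proof. exact: is_derive_continuous (is_derive_concomitant2 x y i j). Qed.

(** Two integrations by parts at once. With [D := y ^+ 4 - x ^+ 4] and
    [g k := qexp 'X^m (a * k)], the function [D g W - g' W2], where [W] and [W2]
    are the two concomitants, has derivative D ^ 2 g P - g'' W2, where [P] is the
    product [dPhi_prod x y k m 0]. *)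
Lemma oscint_green m a x y : 0 < a -> 0 <= x -> 0 <= y ->
  (y ^+ 4 - x ^+ 4) ^+ 2 * oscint 'X^m m 0 a x y =
  a ^+ 2 * \int[mu]_(k in `[0, +oo[)
     (qexp (qderiv (qderiv 'X^m)) (a * k) * concomitant2 x y k m 0).
Proof.
move=> a0 x0 y0; set D := y ^+ 4 - x ^+ 4.
have [C0 C0p HC0] := qexp_bound ('X^m : {poly R}).
have [C1 C1p HC1] := qexp_bound (qderiv 'X^m : {poly R}).
have [C2 C2p HC2] := qexp_bound (qderiv (qderiv 'X^m) : {poly R}).
have Ef0 := exp_bounded_qexpM a0 C0p HC0 (@continuous_dPhi_prod R x y m 0)
  (fun k => @dPhi_prod_bound R x y k m 0 x0 y0).
have Ef2 := exp_bounded_qexpM a0 C2p HC2 (@continuous_concomitant2 x y m 0)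
  (fun k => @concomitant2_bound x y m 0 k x0 y0).
have Eu0 := exp_bounded_qexpM a0 C0p HC0 (@continuous_concomitant1 x y m 0)
  (fun k => @concomitant1_bound x y m 0 k x0 y0).
have Eu1 := exp_bounded_qexpM a0 C1p HC1 (@continuous_concomitant2 x y m 0)
  (fun k => @concomitant2_bound x y m 0 k x0 y0).
have E := exp_boundedB (exp_boundedZ (D ^+ 2) Ef0) (exp_boundedZ (a ^+ 2) Ef2).
have F := exp_boundedB (exp_boundedZ D Eu0) (exp_boundedZ a Eu1).
have dF k : is_derive k (1 : R)
    (fun k => D * (qexp 'X^m (a * k) * concomitant1 x y k m 0) -
      a * (qexp (qderiv 'X^m) (a * k) * concomitant2 x y k m 0))
    (D ^+ 2 * (qexp 'X^m (a * k) * dPhi_prod x y k m 0) -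
      a ^+ 2 * (qexp (qderiv (qderiv 'X^m)) (a * k) * concomitant2 x y k m 0)).
  have dq := is_derive_qexpM 'X^m a k.
  have dq' := is_derive_qexpM (qderiv 'X^m) a k.
  have H0 := is_deriveZ D (is_deriveM dq (is_derive_concomitant1 x y m 0 k)).
  have H1 := is_deriveZ a (is_deriveM dq' (is_derive_concomitant2 x y m 0 k)).
  have H := is_deriveB H0 H1.
  by apply: is_derive_eq; rewrite /GRing.scale /= -/D; ring.
have := exp_bounded_FTC a0 E F dF.
have I0 := exp_bounded_integrable a0 Ef0.
have I2 := exp_bounded_integrable a0 Ef2.
have J0 := exp_bounded_integrable a0 (exp_boundedZ (D ^+ 2) Ef0).
have J2 := exp_bounded_integrable a0 (exp_boundedZ (a ^+ 2) Ef2).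
rewrite RintegralB // !RintegralZl // => H.
apply/eqP; rewrite -subr_eq0 {}H.
(* The boundary term D g W - g' W2 vanishes at 0: W does when m = 0, W2 does
   when m = 1, and g and g' do in all the other cases. *)
rewrite mulr0 oppr_eq0 subr_eq0; apply/eqP.
case: m {HC0 HC1 HC2 Ef0 Ef2 Eu0 Eu1 E F dF I0 I2 J0 J2} => [|[|m]].
- rewrite concomitant1_at0 // /qderiv /qexp expr0 derivC hornerD hornerN hornerZ hornerM.
  by rewrite hornerXn horner0 expr0n /=; ring.
- rewrite concomitant2_at0 // /qexp expr1 hornerX; ring.
- rewrite /qexp /qderiv derivXn hornerD hornerN hornerZ hornerMn.
  by rewrite !hornerXn hornerM !hornerXn !expr0n /=; ring.
Qed.

Lemma subrX4_coef_sum x y : y ^+ 4 - x ^+ 4 = (y - x) * coef_sum x y.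
Proof. by rewrite /coef_sum; ring. Qed.

(** The trivial bound C / a, and the bound C a / (y - x) ^ 2, which follows from
    [oscint_green] since the concomitants are bounded by powers of [coef_sum x y]
    and [y ^+ 4 - x ^+ 4 = (y - x) * coef_sum x y], combine into a multiple of
    the Cauchy density centered at [x] with scale [a]. *)
Lemma oscint_cauchy m : exists2 C, 0 <= C & forall a x y,
  0 < a -> 0 <= x -> 0 <= y ->
  `|oscint 'X^m m 0 a x y| <= C * (a^-1 * (1 + ((y - x) / a) ^+ 2)^-1).
Proof.
have [C C0 HC] := oscint_bound ('X^m : {poly R}).
have [C2 C2p HC2] := qexp_bound (qderiv (qderiv 'X^m) : {poly R}).
exists (C + C2 * 9) => [|a x y a0 x0 y0]; first by rewrite addr_ge0 // mulr_ge0.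
have b1 := HC m 0%N a x y a0 x0 y0.
have b2 : (y - x) ^+ 2 * `|oscint 'X^m m 0 a x y| <= C2 * 9 * a.
  have S0 : 0 <= coef_sum x y by rewrite /coef_sum !addr_ge0 ?mulr_ge0 ?exprn_ge0.
  have [Sz|Sn] := eqVneq (coef_sum x y) 0.
    have [-> ->] : x = 0 /\ y = 0.
      have h1 : 0 <= y ^+ 3 by rewrite exprn_ge0.
      have h2 : 0 <= x * y ^+ 2 by rewrite mulr_ge0 ?exprn_ge0.
      have h3 : 0 <= x ^+ 2 * y by rewrite mulr_ge0 ?exprn_ge0.
      have h4 : 0 <= x ^+ 3 by rewrite exprn_ge0.
      move: Sz; rewrite /coef_sum => Sz.
      have /eqP : x ^+ 3 = 0 by lra.
      have /eqP : y ^+ 3 = 0 by lra.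
      by rewrite !expf_eq0 /= => /eqP-> /eqP->.
    by rewrite subrr expr0n mul0r !mulr_ge0 // ltW.
  have Ef2 := exp_bounded_qexpM a0 C2p HC2 (@continuous_concomitant2 x y m 0)
    (fun k => @concomitant2_bound x y m 0 k x0 y0).
  have := exp_bounded_Rintegral a0 Ef2; set I := Rintegral _ _ _ => bI.
  have S2 : 0 < coef_sum x y ^+ 2 by rewrite exprn_gt0 // lt_neqAle eq_sym Sn.
  rewrite -(ler_pM2l S2).
  have -> : coef_sum x y ^+ 2 * ((y - x) ^+ 2 * `|oscint 'X^m m 0 a x y|) = a ^+ 2 * `|I|.
    rewrite -(ger0_norm (sqr_ge0 a)) -normrM /I -oscint_green // subrX4_coef_sum.
    by rewrite normrM ger0_norm ?sqr_ge0 //; ring.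
  apply: le_trans (ler_wpM2l (sqr_ge0 a) bI) _.
  by rewrite le_eqVlt; apply/orP; left; apply/eqP; field; lra.
have d0 : 0 < 1 + ((y - x) / a) ^+ 2 by rewrite ltr_pwDl // sqr_ge0.
rewrite mulrA ler_pdivlMr // mulrDr mulr1.
rewrite (_ : (C + C2 * 9) / a = C / a + C2 * 9 / a) ?lerD //; last by ring.
rewrite mulrC expr_div_n mulrAC ler_pdivrMr ?exprn_gt0 //.
apply: le_trans b2 _.
by rewrite le_eqVlt; apply/orP; left; apply/eqP; field; lra.
Qed.

End OscillatoryIntegral.

(** * Derivatives of the kernel *)

Section DifferentiationUnderTheIntegral.
Variable R : realType.
Notation mu := (@lebesgue_measure R).
Implicit Types (a s x y z k C l : R) (p : {poly R}) (i j m n : nat) (f : R -> R).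

Lemma within_ge0_dnbhs_proper x : 0 <= x -> ProperFilter (within `[0, +oo[ x^').
Proof.
move=> x0; split; last exact: within_filter.
rewrite /within /= => H; have [e /= e0 He] := H.
have := He (x + e / 2); rewrite /ball /= opprD addrA subrr sub0r normrN.
rewrite gtr0_norm ?divr_gt0 // ltr_pdivrMr // mulr_natr mulr2n ltrDl => /(_ e0).
have n0 : x + e / 2 != x by rewrite -subr_eq0 addrAC subrr add0r gt_eqF // divr_gt0.
by move/(_ n0); apply; rewrite in_itv /= andbT addr_ge0 // divr_ge0 // ltW.
Qed.

(** A quadratic Taylor estimate on the half-line is the form in which
    differentiability under the integral sign is obtained, boundary point
    included. *)
Lemma derive_ge0_quadratic f x l C : 0 <= x -> 0 <= C ->
  (forall z, 0 <= z -> `|f z - f x - (z - x) * l| <= C * (z - x) ^+ 2) ->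
  derive_ge0 f x = l.
Proof.
move=> x0 C0 H; have PF := within_ge0_dnbhs_proper x0.
apply: cvg_lim => //; apply/cvgrPdist_le => /= e e0.
rewrite /within /=; exists (e / (C + 1)) => /=; first by rewrite divr_gt0 // ltr_wpDl.
move=> z /= zx zneq; rewrite in_itv /= andbT => z0.
have d0 : z - x != 0 by rewrite subr_eq0.
have -> : l - (z - x)^-1 * (f z - f x) = - ((z - x)^-1 * (f z - f x - (z - x) * l)).
  by field.
rewrite normrN normrM normfV ler_pdivrMl ?normr_gt0 //.
apply: le_trans (H _ z0) _; rewrite -real_normK ?num_real // expr2 mulrCA ler_wpM2l //.
move: zx; rewrite distrC ltr_pdivlMr ?ltr_wpDl // mulrDr mulr1 mulrC => zx.
by rewrite (le_trans _ (ltW zx)) // lerDl.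
Qed.

Lemma qexp_mulX p s : qexp ('X * p) s = s * qexp p s.
Proof. by rewrite /qexp hornerM hornerX mulrA. Qed.

Lemma normr_qexp_mulX p s : `|qexp ('X * p) s| = `|s| * `|qexp p s|.
Proof. by rewrite qexp_mulX normrM. Qed.

(** Differentiation under the integral sign: the Taylor remainder of [dPhi] on
    the half-line is at most [3 * (k * (z - x)) ^+ 2], and the factor [k ^+ 2] is
    absorbed by the weight. *)
Lemma oscint_taylor p i j a : 0 < a -> exists2 C, 0 <= C & forall x y z,
  0 <= x -> 0 <= y -> 0 <= z ->
  `|oscint p i j a z y - oscint p i j a x y
    - (z - x) * (a^-1 * oscint ('X * p) i.+1 j a x y)| <= C * (z - x) ^+ 2.
Proof.
move=> a0; have [C0 C0p H0] := oscint_exp_bounded p.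
have [C1 C1p H1] := oscint_exp_bounded ('X * p).
have [C2 C2p H2] := qexp_bound ('X * ('X * p)).
exists (9 * C2 / a ^+ 2 / a) => [|x y z x0 y0 z0].
  by rewrite !divr_ge0 ?mulr_ge0 ?exprn_ge0 // ltW.
have Ez := H0 i j a z y a0 z0 y0; have Ex := H0 i j a x y a0 x0 y0.
have E1 := exp_boundedZ (z - x) (exp_boundedZ a^-1 (H1 i.+1 j a x y a0 x0 y0)).
have E := exp_boundedB (exp_boundedB Ez Ex) E1.
have Iz := exp_bounded_integrable a0 Ez; have Ix := exp_bounded_integrable a0 Ex.
have Izx := exp_bounded_integrable a0 (exp_boundedB Ez Ex).
have I1 := exp_bounded_integrable a0 E1.
have I2 := exp_bounded_integrable a0 (exp_boundedZ a^-1 (H1 i.+1 j a x y a0 x0 y0)).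
have I3 := exp_bounded_integrable a0 (H1 i.+1 j a x y a0 x0 y0).
rewrite /oscint -!RintegralZl // -!RintegralB //.
have E' : exp_bounded a (9 * C2 / a ^+ 2 * (z - x) ^+ 2) (fun k =>
    qexp p (a * k) * dPhi_prod z y k i j - qexp p (a * k) * dPhi_prod x y k i j -
    (z - x) * (a^-1 * (qexp ('X * p) (a * k) * dPhi_prod x y k i.+1 j))).
  split; first exact: E.1.
  move=> k k0.
  have -> : qexp p (a * k) * dPhi_prod z y k i j - qexp p (a * k) * dPhi_prod x y k i j -
    (z - x) * (a^-1 * (qexp ('X * p) (a * k) * dPhi_prod x y k i.+1 j)) =
    qexp p (a * k) * (dPhi j (k * y) * (dPhi i (k * z) - dPhi i (k * x) -
      (k * z - k * x) * dPhi i.+1 (k * x))).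
    by rewrite qexp_mulX /dPhi_prod; field; lra.
  have b1 := @dPhi_bound R j (k * y) (mulr_ge0 k0 y0).
  have b2 := @dPhi_taylor R i _ _ (mulr_ge0 k0 z0) (mulr_ge0 k0 x0).
  have b3 := H2 (a * k) (mulr_ge0 (ltW a0) k0).
  rewrite normrM [`|dPhi _ _ * _|]normrM.
  apply: le_trans (ler_wpM2l (normr_ge0 _) (ler_pM (normr_ge0 _) (normr_ge0 _) b1 b2)) _.
  have -> : `|qexp p (a * k)| * (3 * (3 * (k * z - k * x) ^+ 2)) =
      9 / a ^+ 2 * (z - x) ^+ 2 * `|qexp ('X * ('X * p)) (a * k)|.
    rewrite !normr_qexp_mulX [`|a * k|]normrM.
    rewrite (gtr0_norm a0) (ger0_norm k0); field; lra.
  apply: le_trans (ler_wpM2l _ b3) _; first by rewrite mulr_ge0 ?sqr_ge0 ?divr_ge0 ?sqr_ge0.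
  by rewrite le_eqVlt; apply/orP; left; apply/eqP; ring.
apply: le_trans (exp_bounded_Rintegral a0 E') _.
by rewrite le_eqVlt; apply/orP; left; apply/eqP; ring.
Qed.

Lemma oscint_lip p i j a x : 0 < a -> 0 <= x -> exists2 C, 0 <= C & forall y z,
  0 <= y -> 0 <= z ->
  `|oscint p i j a x z - oscint p i j a x y| <= C * `|z - y|.
Proof.
move=> a0 x0; have [C0 C0p H0] := oscint_exp_bounded p.
have [C1 C1p H1] := qexp_bound ('X * p).
exists (9 * C1 / a / a) => [|y z y0 z0].
  by rewrite !divr_ge0 ?mulr_ge0 // ltW.
have Ez := H0 i j a x z a0 x0 z0; have Ey := H0 i j a x y a0 x0 y0.
have Iz := exp_bounded_integrable a0 Ez; have Iy := exp_bounded_integrable a0 Ey.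
rewrite /oscint -!RintegralB //.
have E' : exp_bounded a (9 * C1 / a * `|z - y|) (fun k =>
    qexp p (a * k) * dPhi_prod x z k i j - qexp p (a * k) * dPhi_prod x y k i j).
  split; first exact: (exp_boundedB Ez Ey).1.
  move=> k k0.
  rewrite /dPhi_prod -mulrBr -mulrBr normrM [`|dPhi _ _ * _|]normrM.
  have b1 := @dPhi_bound R i (k * x) (mulr_ge0 k0 x0).
  have b2 := @dPhi_lip R j _ _ (mulr_ge0 k0 z0) (mulr_ge0 k0 y0).
  have b3 := H1 (a * k) (mulr_ge0 (ltW a0) k0).
  apply: le_trans (ler_wpM2l (normr_ge0 _) (ler_pM (normr_ge0 _) (normr_ge0 _) b1 b2)) _.
  have -> : `|qexp p (a * k)| * (3 * (3 * `|k * z - k * y|)) =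
      9 / a * `|z - y| * `|qexp ('X * p) (a * k)|.
    rewrite -mulrBr normr_qexp_mulX [`|k * _|]normrM [`|a * k|]normrM.
    rewrite (gtr0_norm a0) (ger0_norm k0); field; lra.
  apply: le_trans (ler_wpM2l _ b3) _; first by rewrite mulr_ge0 ?divr_ge0 // ltW.
  by rewrite le_eqVlt; apply/orP; left; apply/eqP; ring.
apply: le_trans (exp_bounded_Rintegral a0 E') _.
by rewrite le_eqVlt; apply/orP; left; apply/eqP; ring.
Qed.

(** Precomposing with the absolute value extends the Lipschitz bound from
    the half-line to the whole line. *)
Lemma measurable_oscint p i j a x : 0 < a -> 0 <= x ->
  measurable_fun (`[0, +oo[ : set R) (oscint p i j a x).
Proof.
move=> a0 x0; have [C C0 H] := oscint_lip p i j a0 x0.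
apply: (@eq_measurable_fun _ _ _ _ _ (fun y => oscint p i j a x `|y|)).
  by move=> y; rewrite inE /= in_itv /= andbT => y0; rewrite ger0_norm.
apply: measurable_funTS; apply: continuous_measurable_fun => y.
apply/cvgrPdist_le => /= e e0; exists (e / (C + 1)) => /=.
  by rewrite divr_gt0 // ltr_wpDl.
move=> z /=; rewrite ltr_pdivlMr ?ltr_wpDl // => yz.
apply: le_trans (H _ _ _ _) _ => //.
apply: le_trans (ltW yz); rewrite mulrC ler_pM // ?lerDl //.
exact: ler_dist_dist.
Qed.

Lemma kernelK_oscint a x y : kernelK (a ^+ 4) x y = pi^-1 * oscint 'X^0 0 0 a x y.
Proof.
rewrite /kernelK /oscint; congr (_ * _); apply: eq_Rintegral => k _.
by rewrite /qexp /dPhi_prod !dPhi0 expr0 hornerC mul1r exprMn mulrA [k ^+ 4 * _]mulrC.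
Qed.

Lemma deriven_ge0_kernelK n a x y : 0 < a -> 0 <= x -> 0 <= y ->
  deriven_ge0 n (fun z => kernelK (a ^+ 4) z y) x =
  pi^-1 * a ^- n * oscint 'X^n n 0 a x y.
Proof.
move=> a0 + y0; elim: n x => [|n IH] x x0.
  by rewrite /deriven_ge0 /= kernelK_oscint expr0 invr1 mulr1.
rewrite /deriven_ge0 iterS; have [C C0 H] := oscint_taylor 'X^n n 0 a0.
have c0 : 0 <= pi^-1 * a ^- n :> R by rewrite mulr_ge0 ?invr_ge0 ?pi_ge0 ?exprn_ge0 // ltW.
apply: (@derive_ge0_quadratic _ _ _ (pi^-1 * a ^- n * C)) => //; first by rewrite mulr_ge0.
move=> z z0; rewrite -/(deriven_ge0 _ _) !IH //.
rewrite (exprS 'X n) (exprS a n).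
have -> : pi^-1 * (a * a ^+ n)^-1 = pi^-1 * a ^- n * a^-1 :> R.
  by rewrite invfM; ring.
set c := pi^-1 * a ^- n in c0 *.
have -> : c * oscint 'X^n n 0 a z y - c * oscint 'X^n n 0 a x y
    - (z - x) * (c * a^-1 * oscint ('X * 'X^n) n.+1 0 a x y) =
  c * (oscint 'X^n n 0 a z y - oscint 'X^n n 0 a x y -
    (z - x) * (a^-1 * oscint ('X * 'X^n) n.+1 0 a x y)) by ring.
by rewrite normrM (ger0_norm c0) -[c * C * _]mulrA ler_wpM2l // H.
Qed.

End DifferentiationUnderTheIntegral.

(** * Integrating over the second variable *)

Lemma continuous_cauchy (R : realType) (a x : R) :
  continuous (fun y : R => a^-1 * (1 + ((y - x) / a) ^+ 2)^-1).
Proof.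
move=> y; apply: cvgMl_tmp; apply: cvgV.
  by rewrite gt_eqF // ltr_pwDl // sqr_ge0.
apply: cvgD; first exact: cvg_cst.
have cg : (z - x) / a @[z --> y] --> (y - x) / a.
  by apply: cvgMr_tmp; apply: cvgB; [exact: cvg_id|exact: cvg_cst].
by rewrite expr2; apply: (cvgM cg cg).
Qed.

Lemma integral_cauchy_le_pi (R : realType) (a x : R) : 0 < a ->
  (\int[lebesgue_measure]_(y in `[0%R, +oo[)
     (a^-1 * (1 + ((y - x) / a) ^+ 2)^-1)%:E <= (pi : R)%:E)%E.
Proof.
move=> a0; pose g (y : R) := (y - x) / a.
have dg (y : R) : is_derive y (1 : R) g a^-1.
  by apply: is_derive_eq; rewrite /GRing.scale /= ?mulr0 ?add0r ?addr0 ?subr0 ?mulr1.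
have dG (y : R) : is_derive y (1 : R) (atan \o g) (a^-1 * (1 + ((y - x) / a) ^+ 2)^-1).
  have H := @is_derive1_comp R atan g y _ _ (is_derive1_atan (g y)) (dg y).
  by rewrite mulrC.
have Gy : (atan \o g) y @[y --> +oo] --> (pi / 2 : R).
  apply: (cvg_comp _ _ _ (@cvgy_atan R)).
  apply: gt0_cvgMly; first by rewrite invr_gt0.
  exact: cvg_addrr.
rewrite (ge0_FTC_half_line _ (@continuous_cauchy _ a x) dG Gy) => [|y _]; last first.
  by rewrite mulr_ge0 ?invr_ge0 ?addr_ge0 ?sqr_ge0 // ltW.
rewrite lee_fin /=; have := atan_gtNpi2 (g 0); lra.
Qed.

Theorem lemma1 (R : realType) (m : nat) :
  exists C : R, 0 < C /\
    forall t x : R, 0 < t -> 0 <= x ->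
      (\int[lebesgue_measure]_(y in `[0%R, +oo[)
         `| deriven_ge0 m (fun z : R => kernelK t z y) x |%:E
       <= (C * t `^ (- (m%:R / 4)))%:E)%E.
Proof.
have [C C0 HC] := oscint_cauchy R m.
exists (C + 1); split => [|t x t0 x0]; first by rewrite ltr_wpDl.
pose a := t `^ (4^-1); have a0 : 0 < a by apply: powR_gt0.
have ta : t = a ^+ 4 by rewrite -powR_mulrn ?ltW // -powRrM mulVf // powRr1 // ltW.
have -> : t `^ (- (m%:R / 4)) = a ^- m.
  by rewrite powRN mulrC powRrM powR_mulrn // ltW.
pose c := pi^-1 * a ^- m * C.
have p0 : 0 <= pi^-1 * a ^- m :> R.
  by rewrite mulr_ge0 ?invr_ge0 ?pi_ge0 ?exprn_ge0 // ltW.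
have c0 : 0 <= c by rewrite mulr_ge0.
pose w (y : R) := a^-1 * (1 + ((y - x) / a) ^+ 2)^-1.
have w0 y : 0 <= w y.
  by rewrite mulr_ge0 ?invr_ge0 ?addr_ge0 ?sqr_ge0 // ltW.
have mw : measurable_fun (`[0, +oo[ : set R) w.
  by apply: measurable_funTS; apply: continuous_measurable_fun; exact: continuous_cauchy.
have mK : measurable_fun (`[0, +oo[ : set R)
    (fun y => deriven_ge0 m (fun z : R => kernelK t z y) x).
  apply: (@eq_measurable_fun _ _ _ _ _ (fun y => pi^-1 * a ^- m * oscint 'X^m m 0 a x y)).
    move=> y; rewrite inE /= in_itv /= andbT => y0.
    by rewrite ta deriven_ge0_kernelK.
  by apply: measurable_funM => //; exact: measurable_oscint.
apply: (@le_trans _ _ (\int[lebesgue_measure]_(y in `[0%R, +oo[) (c%:E * (w y)%:E))%E).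
  apply: ge0_le_integral => //=.
  - by apply/measurable_EFinP; apply: measurableT_comp.
  - by apply/measurable_EFinP; apply: measurable_funM.
  - move=> y; rewrite in_itv /= andbT => y0; rewrite lee_fin ta deriven_ge0_kernelK //.
    by rewrite normrM (ger0_norm p0) /c -[_ * C * _]mulrA ler_wpM2l // HC.
rewrite ge0_integralZl //; last 2 first.
- by apply/measurable_EFinP.
- by move=> y _; rewrite lee_fin.
apply: le_trans (lee_wpmul2l _ (integral_cauchy_le_pi x a0)) _; first by rewrite lee_fin.
rewrite -EFinM lee_fin /c.
have -> : pi^-1 * a ^- m * C * pi = C * a ^- m :> R.
  by rewrite mulrC -!mulrA mulVKf ?gt_eqF ?pi_gt0 // mulrC.
by rewrite ler_wpM2r ?invr_ge0 ?exprn_ge0 ?lerDl // ltW.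
Qed.
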